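(* Let $(X_i,d_i)_i$ be a complex and let $(\hat X_i,\hat d_i)_i$, $E_i:\hat X_i\to X_i$, $\hat R_i:X_i\to\hat X_i$ be as in the context, with $\hat d_i=\hat R_{i+1}d_iE_i$. Assume: (C3) for all $i$, $\hat R_{i+1}d_i=\hat d_i\hat R_i$ and $E_{i+1}\hat d_i=d_iE_i$; (A1) for all $i$, $\hat R_i:X_i\to\hat X_i$ is continuous, with operator norm $\|\hat R_i\|$. If, for some index $i$, there is $c_P\ge 0$ such that $$\|x\|_{X,i}\le c_P\|d_ix\|_{X,i+1}\qquad\forall x\in(\ker d_i)^\perp,$$ then $$\|\hat x\|_{\hat X,i}\le c_P\|\hat R_i\|\,\|\hat d_i\hat x\|_{\hat X,i+1}\qquad\forall\hat x\in(\ker\hat d_i)^\perp.$$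
   Context: $(X_i,d_i)_i$ is a complex of finite-dimensional real vector spaces and linear operators ($d_{i+1}d_i=0$). Each $X_i$ is equipped with an inner product $(\cdot,\cdot)_{X,i}$ and its norm $\|\cdot\|_{X,i}$. $(\hat X_i)_i$ is a second sequence of finite-dimensional real vector spaces, $E_i:\hat X_i\to X_i$ (extensions) and $\hat R_i:X_i\to\hat X_i$ (reductions) are linear maps, and $\hat d_i:=\hat R_{i+1}d_iE_i$. The space $\hat X_i$ is equipped with the inner product that makes $E_i$ an isometry: $(\hat x,\hat y)_{\hat X,i}:=(E_i\hat x,E_i\hat y)_{X,i}$, with norm $\|\hat x\|_{\hat X,i}=\|E_i\hat x\|_{X,i}$ (it is understood that this is an inner product, i.e. that $E_i$ is injective). Orthogonal complements $\perp$ are taken in $X_i$ for $(\cdot,\cdot)_{X,i}$ and in $\hat X_i$ for $(\cdot,\cdot)_{\hat X,i}$. *)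

(* Defs.v *)
From HB Require Import structures.
From mathcomp Require Import all_boot all_order all_algebra sesquilinear.
From mathcomp Require Import mathcomp_extra boolp classical_sets reals.
From mathcomp Require Import topology normedtype.
From mathcomp Require Import ring lra.
Set Implicit Arguments.
Unset Strict Implicit.
Unset Printing Implicit Defensive.
Import Order.TTheory GRing.Theory Num.Theory.
Import numFieldNormedType.Exports.
Local Open Scope ring_scope.
Local Open Scope classical_set_scope.

(* Over the reals the involution of a dot product is trivial, so that
   [{dot U for idfun}] is the type of inner products on [U]. *)

Definition dot_norm (R : realType) (U : lmodType R) (form : {dot U for idfun})
  (x : U) : R := Num.sqrt (form x x).

Section DotNorm.
Variables (R : realType) (U : lmodType R) (form : {dot U for idfun}).
Implicit Types (x y : U) (a : R).

Let dotC x y : form x y = form y x.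
Proof. by rewrite (hermitian_subproof x y) expr0 mul1r. Qed.

Let dotDl x y z : form (x + y) z = form x z + form y z.
Proof. exact: linearDl. Qed.

Let dotZl a x y : form (a *: x) y = a * form x y.
Proof. exact: linearZl_LR. Qed.

Let dotDr x y z : form x (y + z) = form x y + form x z.
Proof. by rewrite dotC dotDl !(dotC x). Qed.

Let dotZr a x y : form x (a *: y) = a * form x y.
Proof. by rewrite dotC dotZl dotC. Qed.

Let dot_ge0 x : 0 <= form x x.
Proof.
have [->|/neq0_dnorm_gt0/ltW//] := eqVneq x 0.
by rewrite -{1}(scale0r (0 : U)) dotZl mul0r.
Qed.

Lemma dot_cauchy_schwarz x y : `|form x y| <= dot_norm form x * dot_norm form y.
Proof.
rewrite /dot_norm -sqrtrM// -sqrtr_sqr ler_wsqrtr//.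
have [->|y0] := eqVneq y 0.
  by rewrite -{1}(scale0r (0 : U)) dotZr mul0r expr0n mulr_ge0.
have yy : 0 < form y y by exact: neq0_dnorm_gt0.
have := dot_ge0 (form y y *: x + (- form x y) *: y).
rewrite !(dotDl, dotDr, dotZl, dotZr) (dotC y x) => H.
rewrite -subr_ge0 -(pmulr_rge0 _ yy).
by apply: le_trans H _; rewrite le_eqVlt; apply/orP; left; apply/eqP; ring.
Qed.

Lemma dot_normD x y : dot_norm form (x + y) <= dot_norm form x + dot_norm form y.
Proof.
have nx : 0 <= dot_norm form x by exact: sqrtr_ge0.
have ny : 0 <= dot_norm form y by exact: sqrtr_ge0.
rewrite -(@ler_pXn2r _ 2)// ?nnegrE ?addr_ge0 ?sqrtr_ge0//.
rewrite {1}/dot_norm sqr_sqrtr// sqrrD /dot_norm !sqr_sqrtr//.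
rewrite !(dotDl, dotDr) (dotC y x).
have := le_trans (ler_norm _) (dot_cauchy_schwarz x y).
rewrite /dot_norm => H; lra.
Qed.

Lemma dot_normZ a x : dot_norm form (a *: x) = `|a| * dot_norm form x.
Proof.
by rewrite /dot_norm dotZl dotZr mulrA -expr2 sqrtrM ?sqr_ge0// sqrtr_sqr.
Qed.

Lemma dot_norm_eq0 x : dot_norm form x = 0 -> x = 0.
Proof.
move=> /eqP; rewrite sqrtr_eq0; apply: contraTeq => /(neq0_dnorm_gt0 (s := form)).
by rewrite ltNge.
Qed.

End DotNorm.

(* [U] as a normed module, for the norm of the inner product [form]. *)
Definition dot_space (R : realType) (U : lmodType R) (form : {dot U for idfun})
  : Type := U.

HB.instance Definition _ (R : realType) (U : lmodType R)
    (form : {dot U for idfun}) := GRing.Lmodule.on (dot_space form).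
HB.instance Definition _ (R : realType) (U : lmodType R)
    (form : {dot U for idfun}) :=
  Lmodule_isNormed.Build R (dot_space form)
    (dot_normD form) (dot_normZ form) (dot_norm_eq0 (form := form)).

Lemma dot_space_normE (R : realType) (U : lmodType R)
  (form : {dot U for idfun}) (x : dot_space form) : `|x| = dot_norm form x.
Proof. by []. Qed.

Definition dot_opnorm (R : realType) (U V : lmodType R)
    (formU : {dot U for idfun}) (formV : {dot V for idfun}) (f : U -> V) : R :=
  sup [set dot_norm formV (f x) | x in [set x | dot_norm formU x <= 1]].

Section PullbackDot.
Variables (R : realType) (U V : lmodType R) (formV : {dot V for idfun}).
Variables (f : {linear U -> V}) (fI : injective f).

(* The injectivity proof is a parameter because it is what makes this form
   positive definite. *)
Definition pullback_dot of injective f := fun x y : U => formV (f x) (f y).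

Local Notation pform := (pullback_dot fI).

Let pform_bilinear : bilinear_for *%R (idfun \; *%R) pform.
Proof. by split=> z a x y; rewrite /pullback_dot linearP ?linearPl ?linearPr. Qed.

Let pform_hermitian x y : pform x y = (-1) ^+ false * idfun (pform y x).
Proof. exact: hermitian_subproof. Qed.

Let pform_gt0 x : x != 0 -> 0 < pform x x.
Proof.
by move=> x0; apply: neq0_dnorm_gt0; rewrite -(linear0 f) (inj_eq fI).
Qed.

HB.instance Definition _ :=
  @bilinear_isBilinear.Build R U U R *%R (idfun \; *%R) pform pform_bilinear.
HB.instance Definition _ :=
  @isHermitianSesquilinear.Build R U false idfun pform pform_hermitian.
HB.instance Definition _ := @isDotProduct.Build R U pform pform_gt0.
End PullbackDot.

Definition reduced_diff (R : realType) (X Xh : int -> vectType R)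
    (d : forall i, 'Hom(X i, X (i + 1)))
    (E : forall i, 'Hom(Xh i, X i)) (Rh : forall i, 'Hom(X i, Xh i))
    (i : int) : 'Hom(Xh i, Xh (i + 1)) :=
  (Rh (i + 1) \o d i \o E i)%VF.

(* Main.v *)
Require Import Defs.
From HB Require Import structures.
From mathcomp Require Import all_boot all_order all_algebra sesquilinear.
From mathcomp Require Import mathcomp_extra boolp classical_sets reals.
From mathcomp Require Import topology normedtype.
Set Implicit Arguments.
Unset Strict Implicit.
Unset Printing Implicit Defensive.
Import Order.TTheory GRing.Theory Num.Theory.
Import numFieldNormedType.Exports.
Local Open Scope ring_scope.

(* Let x be the component of E xh orthogonal to ker d.  By (C3), both d x and
   d (E xh) equal E (dh xh), so the hypothesis bounds |x| by cP |dh xh|.  Again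
   by (C3), dh (Rh x) = Rh (d (E xh)) = dh xh, although Rh (E xh) need not equal
   xh.  Hence xh - Rh x lies in ker dh and is orthogonal to xh, which gives
   |xh| <= |Rh x| <= |Rh| |x| by Cauchy-Schwarz. *)

(** Gram-Schmidt by induction on the spanning list, which may be linearly dependent: project on the
    span of the tail, then correct along the part [w] of the head [v] that is orthogonal to that
    span. *)
Lemma orthov_span_decomp (R : realType) (U : vectType R)
    (form : {dot U for idfun}) (s : seq U) (x : U) :
  exists2 z, z \in <<s>>%VS & x - z \in orthov form <<s>>.
Proof.
elim: s x => [|v s IH] x.
  by exists 0; rewrite ?mem0v// span_nil orthov0 memvf.
have [z zs yo] := IH x; have [zv zvs wo] := IH v.
set y := x - z in yo; set w := v - zv in wo.
(* Coefficient of the projection of [y] on the line of [w]. If [v] already lies in the span of [s],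
   then [w] is 0 and the quotient is 0 by convention. *)
pose c := form y w / form w w.
exists (z + c *: w).
  rewrite scalerBr addrCA span_cons memv_add ?memvZ ?memv_line//.
  by rewrite rpredB// rpredZ.
have xo : x - (z + c *: w) \in orthov form <<s>>.
  by rewrite opprD addrA rpredB// rpredZ.
apply/mem_orthovP => u.
(* Write [u] as [k *: v + t] and [v] as [w + zv]. By [xo], the residual is orthogonal to [t] and
   [zv], so only its product with [w] remains, and the choice of [c] makes it vanish. *)
rewrite span_cons => /memv_addP[_ /vlineP[k ->] [t ts ->]].
rewrite linearDr/= (mem_orthovP xo t)// addr0 linearZr/=.
rewrite -[v](subrK zv) -/w linearDr/= (mem_orthovP xo zv)// addr0.
rewrite opprD addrA -/y linearBl/= linearZl_LR/= /c.
have [->|w0] := eqVneq w 0; first by rewrite !linear0r !mulr0 subr0 mulr0.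
by rewrite divfK ?subrr ?mulr0// gt_eqF// neq0_dnorm_gt0.
Qed.

Lemma orthov_decomp (R : realType) (U : vectType R)
    (form : {dot U for idfun}) (V : {vspace U}) (x : U) :
  exists2 z, z \in V & x - z \in orthov form V.
Proof.
by have := orthov_span_decomp form (vbasis V) x; rewrite (span_basis (vbasisP V)).
Qed.

(** A supremum of norms dominates some norm; when the set has no supremum, [sup] takes the default
    value 0. *)
Lemma dot_opnorm_ge0 (R : realType) (U V : lmodType R)
    (formU : {dot U for idfun}) (formV : {dot V for idfun}) (f : U -> V) :
  0 <= dot_opnorm formU formV f.
Proof.
rewrite /dot_opnorm; set E := (X in sup X).
have [supE|/sup_out->//] := pselect (has_sup E).
have [r Er] := supE.1; apply: (le_trans _ (sup_upper_bound supE Er)).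
by case: Er => x _ <-; exact: sqrtr_ge0.
Qed.

(** Continuity makes [f] bounded on the unit ball, so that the [sup] is a genuine upper bound; it is
    then applied to [x] divided by its norm. *)
Lemma dot_opnorm_le (R : realType) (U V : lmodType R)
    (formU : {dot U for idfun}) (formV : {dot V for idfun}) (f : {linear U -> V}) :
  continuous (f : dot_space formU -> dot_space formV) ->
  forall x, dot_norm formV (f x) <= dot_opnorm formU formV f * dot_norm formU x.
Proof.
move=> f_cont x.
pose g : {linear dot_space formU -> dot_space formV} := f.
have /bounded_funP/(_ 1)[M gM] : bounded_near g (nbhs (0 : dot_space formU)).
  exact: continuous_linear_bounded (f_cont _).
have [->|x0] := eqVneq x 0.
  rewrite linear0 -(scale0r (0 : U)) -(scale0r (0 : V)).
  by rewrite !dot_normZ normr0 !mul0r mulr0.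
have nx : 0 < dot_norm formU x by rewrite sqrtr_gt0 neq0_dnorm_gt0.
rewrite -ler_pdivrMr// mulrC -[_^-1]gtr0_norm ?invr_gt0// -dot_normZ -linearZ.
apply: ub_le_sup; first by exists M => _ [y /= y1 <-]; exact: gM.
exists ((dot_norm formU x)^-1 *: x) => //=.
by rewrite dot_normZ gtr0_norm ?invr_gt0// mulVf ?gt_eqF.
Qed.

Theorem proposition4 (R : realType) (X Xh : int -> vectType R)
    (ipX : forall i : int, {dot X i for idfun})
    (d : forall i : int, 'Hom(X i, X (i + 1)))
    (E : forall i : int, 'Hom(Xh i, X i))
    (Rh : forall i : int, 'Hom(X i, Xh i))
    (d_complex : forall i : int, (d (i + 1) \o d i)%VF = 0)
    (E_inj : forall i : int, injective (E i)) :
  let dh : forall i : int, 'Hom(Xh i, Xh (i + 1)) := reduced_diff d E Rh in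
  let ipXh : forall i : int, {dot Xh i for idfun} :=
    fun i => pullback_dot (ipX i) (E_inj i) in
  (forall i : int, (Rh (i + 1) \o d i)%VF = (dh i \o Rh i)%VF /\
                   (E (i + 1) \o dh i)%VF = (d i \o E i)%VF) ->
  (forall i : int,
     continuous (Rh i : dot_space (ipX i) -> dot_space (ipXh i))) ->
  forall (i : int) (cP : R), 0 <= cP ->
  (forall x : X i, x \in orthov (ipX i) (lker (d i)) ->
     dot_norm (ipX i) x <= cP * dot_norm (ipX (i + 1)) (d i x)) ->
  forall xh : Xh i, xh \in orthov (ipXh i) (lker (dh i)) ->
    dot_norm (ipXh i) xh <=
      cP * dot_opnorm (ipX i) (ipXh i) (Rh i) *
      dot_norm (ipXh (i + 1)) (dh i xh).
Proof.
move=> dh ipXh C3 Rh_cont i cP cP0 poincare xh xh_perp.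
have [/lfunP Rd /lfunP Ed] := C3 i.
have dEx : d i (E i xh) = E (i + 1) (dh i xh).
  by have := Ed xh; rewrite !comp_lfunE.
have [z zK xP] := orthov_decomp (ipX i) (lker (d i)) (E i xh).
set x := E i xh - z in xP.
have dx : d i x = E (i + 1) (dh i xh).
  by rewrite linearB/= (eqP (_ : d i z == 0)) -?memv_ker// subr0.
have dhRx : dh i (Rh i x) = dh i xh.
  by have := Rd x; rewrite !comp_lfunE dx -dEx => <-.
have xhE : ipXh i xh xh = ipXh i xh (Rh i x).
  apply/eqP; rewrite -subr_eq0 -linearBr/=; apply/eqP.
  by apply: (mem_orthovP xh_perp); rewrite memv_ker linearB/= dhRx subrr.
have xh_le : dot_norm (ipXh i) xh <= dot_norm (ipXh i) (Rh i x).
  have := dot_cauchy_schwarz (ipXh i) xh (Rh i x).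
  have xh2 : ipXh i xh xh = dot_norm (ipXh i) xh ^+ 2.
    rewrite sqr_sqrtr//; have [->|] := eqVneq xh 0; first by rewrite linear0r.
    by move=> /(neq0_dnorm_gt0 (s := ipXh i))/ltW.
  rewrite -xhE xh2 ger0_norm ?sqr_ge0// expr2.
  (* Cauchy-Schwarz now bounds the square of the norm of [xh] by its product with the norm of
     [Rh i x]; one factor cancels unless it is zero. *)
  have [-> _|/eqP n0] := eqVneq (dot_norm (ipXh i) xh) 0; first exact: sqrtr_ge0.
  by rewrite ler_pM2l// lt_neqAle eq_sym sqrtr_ge0 andbT; apply/eqP.
apply: le_trans xh_le _.
apply: le_trans (dot_opnorm_le (Rh_cont i) x) _.
(* The norm on [Xh (i + 1)] is by definition the norm of the image under [E (i + 1)]. *)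
have -> : dot_norm (ipXh (i + 1)) (dh i xh) = dot_norm (ipX (i + 1)) (d i x).
  by rewrite dx.
rewrite mulrAC mulrC; apply: ler_wpM2r; last exact: poincare.
exact: dot_opnorm_ge0.
Qed.
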